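(* Let $n$ be a positive integer and let $q$ be a prime power. If $n$ is odd, then $$|ST_n(\mathbb{F}_q,a)|=|ST_n(\mathbb{F}_q,1)|$$ for all $a\in U(\mathbb{F}_q)$.
   Context: $\mathbb{F}_q$ is the finite field with $q$ elements and $U(\mathbb{F}_q)$ is its group of units (nonzero elements). For $n\ge 1$, $ST_n(\mathbb{F}_q)$ is the set of $n\times n$ symmetric tridiagonal matrices over $\mathbb{F}_q$, i.e. symmetric matrices whose entries outside the main diagonal, the subdiagonal and the superdiagonal are zero. For $a\in\mathbb{F}_q$, $ST_n(\mathbb{F}_q,a)=\{A\in ST_n(\mathbb{F}_q):\det(A)=a\}$. *)

(* Defs.v *)
From mathcomp Require Import all_boot all_order all_algebra.

Set Implicit Arguments.
Unset Strict Implicit.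
Unset Printing Implicit Defensive.

Import GRing.Theory.
Local Open Scope ring_scope.

Definition tridiagonal (R : nmodType) (n : nat) (A : 'M[R]_n) : bool :=
  [forall i : 'I_n, forall j : 'I_n,
    ((i.+1 < j)%N || (j.+1 < i)%N) ==> (A i j == 0)].

Definition ST (F : finFieldType) (n : nat) : {set 'M[F]_n} :=
  [set A : 'M[F]_n | (A \is symmetricmx) && tridiagonal A].

Definition STdet (F : finFieldType) (n : nat) (a : F) : {set 'M[F]_n} :=
  [set A in ST F n | \det A == a].

(* Main.v *)
Require Import Defs.
From mathcomp Require Import all_boot all_order all_algebra.

Set Implicit Arguments.
Unset Strict Implicit.
Unset Printing Implicit Defensive.

Import GRing.Theory.
Local Open Scope ring_scope.

(** For [n = 2k+1] and a unit [u], put [D = diag(u^-k, 1, ..., 1)].  The map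
    [A |-> u D A D] is an injection of symmetric tridiagonal matrices which
    multiplies the determinant by [u^n u^(-2k) = u].  Applying it with [a] and
    with [a^-1] compares the two cardinals in both directions. *)

Lemma symmetricmxP (R : fieldType) n (A : 'M[R]_n) :
  reflect (A^T = A) (A \is symmetricmx).
Proof.
(* [symmetricmx] is the Hermitian predicate with sign [(-1) ^+ 0] and the identity as conjugation;
   both are stripped here. *)
by rewrite qualifE /= expr0 scale1r map_mx_id // eq_sym; apply: eqP.
Qed.

Lemma symmetricmx_diag_congr (R : fieldType) n (d : 'rV[R]_n) (A : 'M[R]_n) :
  A \is symmetricmx -> diag_mx d *m A *m diag_mx d \is symmetricmx.
Proof.
move=> /symmetricmxP symA; apply/symmetricmxP.
by rewrite !trmx_mul tr_diag_mx symA mulmxA.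
Qed.

(** The [(i, j)] entry becomes [d_i * A i j * d_j], so every zero of [A] survives. *)
Lemma tridiagonal_diag_congr (R : pzRingType) n (d : 'rV[R]_n) (A : 'M[R]_n) :
  tridiagonal A -> tridiagonal (diag_mx d *m A *m diag_mx d).
Proof.
move=> /forallP triA; apply/forallP => i; apply/forallP => j; apply/implyP.
move/implyP: (forallP (triA i) j) => /[apply] /eqP Aij0.
by rewrite mul_mx_diag mul_diag_mx !mxE Aij0 mulr0 mul0r.
Qed.

Lemma ST_scale (F : finFieldType) n (u : F) (A : 'M[F]_n) :
  A \in ST F n -> u *: A \in ST F n.
Proof.
rewrite !inE => /andP[/symmetricmxP symA /forallP triA]; apply/andP; split.
  by apply/symmetricmxP; rewrite linearZ /= symA.
apply/forallP => i; apply/forallP => j; apply/implyP.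
move/implyP: (forallP (triA i) j) => /[apply] /eqP Aij0.
by rewrite mxE Aij0 mulr0.
Qed.

Lemma leq_card_STdet_mul (F : finFieldType) n (u b : F) :
  odd n -> u != 0 -> (#|STdet n b| <= #|STdet n (u * b)%R|)%N.
Proof.
case: n => [//|n] n_odd u_neq0.
(* From here [n] is the size minus one, hence even, and [n./2] is the [k] of the overview. *)
pose d : 'rV[F]_n.+1 := \row_i (if i == 0 then u ^- n./2 else 1).
have detD : \det (diag_mx d) = u ^- n./2.
  rewrite det_diag big_ord_recl mxE eqxx big1 ?mulr1 // => i _.
  by rewrite mxE.
have unitD : diag_mx d \in unitmx.
  by rewrite unitmxE detD unitfE invr_eq0 expf_neq0.
pose f (A : 'M_n.+1) := u *: (diag_mx d *m A *m diag_mx d).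
have f_inj : injective f.
  (* Cancel the scalar, then the right and left factors [diag_mx d], which is invertible. *)
  move=> A B /(scalerI u_neq0) /(can_inj (mulmxK unitD)).
  exact: (can_inj (mulKmx unitD)).
rewrite -(card_imset _ f_inj); apply/subset_leq_card/subsetP => _ /imsetP[A + ->].
rewrite inE => /andP[STA /eqP detA]; rewrite inE; apply/andP; split.
  apply: ST_scale; move: STA; rewrite !inE => /andP[symA triA].
  by rewrite symmetricmx_diag_congr // tridiagonal_diag_congr.
have n_even : n = (n./2 + n./2)%N by rewrite addnn even_halfK.
rewrite detZ !det_mulmx detA detD exprS {1}n_even exprD; apply/eqP.
have : u ^+ n./2 != 0 by rewrite expf_neq0.
(* With [v = u ^+ n./2], what remains is [u * (v * v) * (v^-1 * b * v^-1) = u * b]. *)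
move: (u ^+ n./2) => v v_neq0.
by rewrite -!mulrA mulVKf // [v * _]mulrCA divff // mulr1.
Qed.

Theorem theorem2p14 (F : finFieldType) (n : nat) (n_gt0 : (0 < n)%N)
    (n_odd : odd n) (a : F) (a_unit : a \is a GRing.unit) :
  #|STdet n a| = #|STdet n (1 : F)|.
Proof.
have a_neq0 : a != 0 by rewrite -unitfE.
have aV_neq0 : a^-1 != 0 by rewrite invr_eq0.
apply/eqP; rewrite eqn_leq; apply/andP; split.
  by have := leq_card_STdet_mul a n_odd aV_neq0; rewrite mulVf.
by have := leq_card_STdet_mul 1 n_odd a_neq0; rewrite mulr1.
Qed.
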